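(* Let $G$ be a group, let $H$ be a subgroup of $G$, and let $k$ be an integer. Then the number of elements $x\in G$ such that $x^k\in H$ is divisible by $|H|$.
   Context: The group $G$ need not be finite; divisibility is understood in the sense of cardinal arithmetic: any infinite cardinal is divisible by any smaller or equal nonzero cardinal, and zero is divisible by any cardinal. *)

(* Defs.v *)
From mathcomp Require Import all_boot all_order all_algebra.
From mathcomp Require Import all_classical.
Set Implicit Arguments.
Unset Strict Implicit.
Unset Printing Implicit Defensive.
Local Open Scope classical_set_scope.
Local Open Scope card_scope.

(* [Negz n] stands for the integer -(n + 1). *)
Definition expgz (G : groupType) (x : G) (k : int) : G :=
  match k with
  | Posz n => (x ^+ n)%g
  | Negz n => (x ^- n.+1)%g
  end.

(* Divisibility of cardinals: |A| divides |B| when |B| = |A| * |C| for some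
   cardinal |C|.  In particular 0 is divisible by every cardinal, and an
   infinite cardinal by every nonzero cardinal not exceeding it. *)
Definition card_dvd (T U : Type) (A : set T) (B : set U) : Prop :=
  exists (V : Type) (C : set V), B #= A `*` C.

(* Main.v *)
Require Import Defs.
From mathcomp Require Import all_boot all_order all_algebra.
From mathcomp Require Import all_classical.
Local Open Scope classical_set_scope.

(** For [x] in [G] let [D x] be the largest subgroup of [H] normalized by [x].
    The condition [x ^+ k \in H] is invariant under conjugation by [H] and under
    [x |-> x * d] with [d] in [D x].  Conjugation by [H] permutes the cosets
    [x * D x], which partition [G], and the stabilizer of [x * D x] in [H] is
    [D x] itself: if [h] stabilizes it then [h ^ x] lies in [D x * h], so that
    [D x * h] is a subset of [H] stable under conjugation by [x].  Hence the
    orbit of [x * D x] consists of [|H : D x|] disjoint cosets of cardinality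
    [|D x|], and the solutions are partitioned into sets of cardinality [|H|]. *)

Section Core.
Set Implicit Arguments.
Unset Strict Implicit.
Local Open Scope group_scope.
Context (G : groupType) (H : set G) (subgH : group_closed (mem H)).
Implicit Types (x y z d e g h : G) (S : set G) (n : nat) (k : int).

Let H1 : H 1. Proof. by case: subgH => /set_mem. Qed.

Let HM x y : H x -> H y -> H (x * y).
Proof.
by move=> Hx Hy; apply/set_mem/(group_closedM subgH); apply: mem_set.
Qed.

Let HV x : H x -> H x^-1.
Proof. by move=> Hx; apply/set_mem/(group_closedV subgH)/mem_set. Qed.

Let HVE x : H x^-1 <-> H x.
Proof. by split=> /HV; rewrite ?invgK. Qed.

Let HJ x h : H h -> H (x ^ h) <-> H x.
Proof.
move=> Hh; split=> Hx; last by rewrite conjgE; apply/HM/HM => //; apply: HV.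
by rewrite -(conjgK h x) conjgE invgK; apply/HM/HM => //; apply: HV.
Qed.

Definition conj_stable x S := forall s, S (s ^ x) <-> S s.

(* As a union of subsets rather than of subgroups; it is nevertheless a
   subgroup, because products of [x]-stable subsets are [x]-stable. *)
Definition core x : set G :=
  [set d | exists S, [/\ S `<=` H, conj_stable x S & S d]].

Lemma core_sub x : core x `<=` H.
Proof. by move=> d [S [SH _ /SH]]. Qed.

Lemma core1 x : core x 1.
Proof.
exists [set 1]; split=> // [_ -> //|s].
by split=> /= [|->]; rewrite ?conj1g // => /eqP; rewrite conjg_eq1 => /eqP.
Qed.

Lemma coreV x d : core x d -> core x d^-1.
Proof.
case=> S [SH Sx Sd]; exists [set s | S s^-1]; split=> /=; last by rewrite invgK.
  by move=> s /= /SH /HVE.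
by move=> s /=; rewrite -conjVg; apply: Sx.
Qed.

Lemma coreM x d e : core x d -> core x e -> core x (d * e).
Proof.
case=> S [SH Sx Sd] [T [TH Tx Te]].
exists [set s | exists a b, [/\ S a, T b & s = a * b]]; split=> /=.
- by move=> _ /= [a [b [/SH Ha /TH Hb ->]]]; apply: HM.
- move=> s /=; split=> [[a [b [Sa Tb sab]]]|[a [b [Sa Tb ->]]]].
    exists (a ^ x^-1), (b ^ x^-1); rewrite -conjMg -sab conjgK.
    by split=> //; [apply/Sx | apply/Tx]; rewrite conjgKV.
  by exists (a ^ x), (b ^ x); rewrite -conjMg; split=> //; [apply/Sx | apply/Tx].
- by exists d, e.
Qed.

Lemma coreJ x d : core x (d ^ x) <-> core x d.
Proof. by split=> -[S [SH Sx Sd]]; exists S; split=> //; apply/Sx. Qed.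

Lemma core_max x S : S `<=` H -> conj_stable x S -> S `<=` core x.
Proof. by move=> SH Sx s Ss; exists S. Qed.

(** Conjugation by [x * d] is conjugation by [x] followed by conjugation by [d], and both preserve
    the subgroup [core x]. *)
Lemma core_mulr x d : core x d -> core (x * d) = core x.
Proof.
(* One inclusion suffices: the other is the same one for [x * d] and [d^-1]. *)
suff subD y e : core y e -> core y `<=` core (y * e).
  move=> Dd; apply/seteqP; split; last exact: subD.
  by rewrite -{2}(mulgK d x); apply/(subD _ _)/coreV/(subD _ _ Dd).
move=> De; apply: core_max (@core_sub y) _ => s; rewrite conjgM.
rewrite -(coreJ y s); split=> Ds.
  rewrite -(conjgK e (s ^ y)) conjgE invgK.
  by apply: coreM De (coreM Ds (coreV De)).
by rewrite conjgE; apply: coreM (coreV De) (coreM Ds De).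
Qed.

Lemma core_conj x d h : H h -> core (x ^ h) (d ^ h) <-> core x d.
Proof.
suff cJ y e g : H g -> core y e -> core (y ^ g) (e ^ g).
  by move=> Hh; split=> [/(cJ _ _ _ (HV Hh))|]; [rewrite !conjgK | exact: cJ].
move=> Hg [S [SH Sy Se]]; exists [set s | S (s ^ g^-1)]; split=> /=.
- by move=> s /= /SH; rewrite HJ //; apply: HV.
- by move=> s /=; rewrite conjJg conjgK Sy.
- by rewrite conjgK.
Qed.

Lemma stabilizer_core x d h : H h -> core x d -> h ^ x = d * h -> core x h.
Proof.
(* [S] is the right coset [core x * h]. *)
move=> Hh Dd hx; pose S := [set s | core x (s / h)].
apply: (@core_max x S); last by rewrite /S /= mulgV; apply: core1.
  by move=> s /= /core_sub Hs; rewrite -(mulgVK h s); apply: HM.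
move=> s; rewrite /S /=.
have -> : s ^ x / h = (s / h) ^ x * d.
  by rewrite conjMg conjVg hx invgM !mulgA mulgVK.
rewrite -(coreJ x (s / h)); split=> Ds; last exact: coreM.
by rewrite -(mulgK d (_ ^ x)); apply: coreM (coreV Dd).
Qed.

(** Since [x] normalizes [core x], the factors [d] can be moved to the right past the powers of
    [x]. *)
Lemma expg_mul_core n x d : core x d ->
  exists2 e, core x e & (x * d) ^+ n = x ^+ n * e.
Proof.
move=> Dd; elim: n => [|n [e De IHn]].
  by exists 1; rewrite ?mulg1 ?expg0 //; apply: core1.
exists (e ^ x * d); first by apply: coreM => //; apply/coreJ.
by rewrite !expgSr IHn conjgE -!mulgA mulVKg.
Qed.

(** The union of the [H]-conjugates of the coset [x * core x]; these unions are the classes of an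
    equivalence relation. *)
Definition core_orbit x : set G :=
  [set y | exists h d, [/\ H h, core x d & y = (x * d) ^ h]].

Lemma core_orbit_refl x : core_orbit x x.
Proof.
by exists 1, 1; rewrite mulg1 conjg1; split=> //; apply: core1.
Qed.

Lemma core_orbit_sym x y : core_orbit x y -> core_orbit y x.
Proof.
move=> [h [d [Hh Dd ->]]]; exists h^-1, (d^-1 ^ h); split; first exact: HV.
  by apply/core_conj => //; rewrite core_mulr //; apply: coreV.
by rewrite -conjMg conjgK mulgK.
Qed.

Lemma core_orbit_trans x y z : core_orbit x y -> core_orbit y z ->
  core_orbit x z.
Proof.
move=> [h [d [Hh Dd ->]]] [g [e [Hg De ->]]].
exists (h * g), (d * e ^ h^-1); split; first exact: HM.
  apply: coreM => //; rewrite -(core_mulr Dd).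
  by apply/(core_conj _ _ Hh); rewrite conjgKV.
by rewrite [RHS]conjgM mulgA (conjMg (x * d)) conjgKV.
Qed.

Lemma core_orbit_eq x y : core_orbit x y -> core_orbit x = core_orbit y.
Proof.
move=> xy; apply/seteqP; split=> z; last exact: core_orbit_trans.
exact/core_orbit_trans/core_orbit_sym.
Qed.

Lemma core_orbit_expgz k x y :
  core_orbit x y -> H (expgz x k) -> H (expgz y k).
Proof.
move=> [h [d [Hh Dd ->]]].
have expH n : H (x ^+ n) -> H (((x * d) ^ h) ^+ n).
  rewrite -conjXg => Hx; apply/HJ => //.
  by have [e /core_sub He ->] := expg_mul_core n Dd; apply: HM.
by case: k => n /=; [|move/HVE => Hx; apply/HVE; move: Hx]; apply: expH.
Qed.

(** A chosen element of the right coset [core x * h]. The default [1] never matters, because [h]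
    itself is a candidate. *)
Definition core_coset_repr x h := xget 1 [set t | core x (h / t)].

Lemma core_coset_reprP x h : core x (h / core_coset_repr x h).
Proof.
apply: (@xgetPex _ 1 [set t | core x (h / t)]).
by exists h; rewrite /= mulgV; apply: core1.
Qed.

Lemma core_coset_repr_in x h : H h -> H (core_coset_repr x h).
Proof.
move=> Hh; have /core_sub Hd := core_coset_reprP x h.
rewrite -[core_coset_repr x h]invgK -(mulKg h (core_coset_repr x h)^-1).
exact/HV/HM/Hd/HV.
Qed.

Lemma core_coset_repr_eq x g h :
  core x (g / h) -> core_coset_repr x g = core_coset_repr x h.
Proof.
move=> Dgh; rewrite /core_coset_repr; congr xget; apply/seteqP; split=> t /= Dt.
  rewrite -(mulgVK g h) -mulgA; apply: coreM => //.
  by rewrite -invgF; apply: coreV.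
by rewrite -(mulgVK h g) -mulgA; apply: coreM.
Qed.

(* With [h = d * t], [d] in [core x] and [t] representing the coset
   [core x * h], sends [h] to the conjugate of [x * d] by [t]. *)
Definition core_orbit_param x h :=
  (x * (h / core_coset_repr x h)) ^ core_coset_repr x h.

Lemma core_orbit_paramP x h : H h -> core_orbit x (core_orbit_param x h).
Proof.
move=> Hh; exists (core_coset_repr x h), (h / core_coset_repr x h); split=> //.
  exact: core_coset_repr_in.
exact: core_coset_reprP.
Qed.

Lemma core_orbit_param_surj x y :
  core_orbit x y -> exists2 h, H h & core_orbit_param x h = y.
Proof.
move=> [h [d [Hh Dd ->]]]; set t := core_coset_repr x h.
have Dht : core x (h / t) := core_coset_reprP x h.
have Ht : H t by apply: core_coset_repr_in.
(* [(x * d) ^ h = (x * d') ^ t] *)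
pose d' := (h / t)^-1 ^ x * d * (h / t).
have Dd' : core x d'.
  by apply: coreM => //; apply: coreM => //; apply/coreJ; apply: coreV.
(* [d' * t] lies in the same right coset as [h], so both have the representative [t]. *)
have rt : core_coset_repr x (d' * t) = t.
  rewrite -[RHS](@core_coset_repr_eq x (d' * t) h _) //.
  by rewrite -mulgA; apply: coreM => //; rewrite -invgF; apply: coreV.
exists (d' * t); first by apply: HM => //; apply: core_sub Dd'.
rewrite /core_orbit_param rt mulgK.
have -> : x * d' = (x * d) ^ (h / t).
  by rewrite /d' !conjgE !mulgA mulgV mul1g.
by rewrite -conjgM mulgVK.
Qed.

Lemma core_orbit_param_inj x g h :
  H g -> H h -> core_orbit_param x g = core_orbit_param x h -> g = h.
Proof.
move=> Hg Hh; rewrite /core_orbit_param.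
have := core_coset_reprP x g; have := core_coset_repr_in x Hg.
have := core_coset_reprP x h; have := core_coset_repr_in x Hh.
move Es : (core_coset_repr x h) => s; move Et : (core_coset_repr x g) => t.
move Ee : (h / s) => e; move Ed : (g / t) => d => Hs De Ht Dd eq_ts.
have Hu : H (t / s) by apply/HM/HV.
have xdu : (x * d) ^ (t / s) = x * e by rewrite conjgM eq_ts conjgK.
(* [t / s] normalizes [core x], since it maps the coset [x * core x] to itself. *)
have DJ a : core x (a ^ (t / s)) <-> core x a.
  by rewrite -{1}(core_mulr De) -xdu core_conj // core_mulr.
have Du : core x (t / s).
  (* With [u = t / s], the equation [x * d * u = u * x * e] gives [u ^ x = d * u * e^-1 = d * (u *
     e^-1 * u^-1) * u]. *)
  apply: (@stabilizer_core x (d * e^-1 ^ (t / s)^-1)) => //.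
    by apply: coreM => //; apply/DJ; rewrite conjgKV; apply: coreV.
  have xue : (t / s) * x * e = x * d * (t / s).
    by rewrite -mulgA -xdu -(conjgC (x * d)).
  apply: (mulgI x); apply: (mulIg e); rewrite -(conjgC (t / s)) xue.
  by move: (t / s) => u; rewrite conjgE invgK !mulgA !mulgVK.
have st : t = s.
  rewrite -Et -Es; apply: core_coset_repr_eq.
  have -> : g / h = d * (t / s) / e.
    by rewrite -Ed -Ee invgF !mulgA !mulgVK.
  by apply: coreM (coreV De); apply: coreM.
have de : d = e.
  by apply: (mulgI x); apply: (conjg_inj s); rewrite -[in LHS]st.
by rewrite -(mulgVK t g) Ed de st -Ee mulgVK.
Qed.

Definition core_orbit_repr x := xget 1 (core_orbit x).

Lemma core_orbit_reprP x : core_orbit x (core_orbit_repr x).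
Proof. by apply: xgetPex; exists x; apply: core_orbit_refl. Qed.

Lemma core_orbit_repr_eq x y :
  core_orbit x y -> core_orbit_repr x = core_orbit_repr y.
Proof. by move=> /core_orbit_eq; rewrite /core_orbit_repr => ->. Qed.

(** The cofactor is the set of chosen representatives of the classes that make up [X]. Each class is
    parametrized by [H] from its representative, which gives an explicit bijection that needs no
    finiteness. *)
Lemma card_dvd_core_orbit (X : set G) :
  (forall x y, core_orbit x y -> X x -> X y) -> card_dvd H X.
Proof.
move=> Xorb; exists G, (core_orbit_repr @` X).
pose F (p : G * G) := core_orbit_param p.2 p.1.
have {1}-> : X = F @` (H `*` (core_orbit_repr @` X)).
  apply/seteqP; split=> [x Xx|_ [[h _] /= [Hh [x Xx <-]] <-]].
    have [h Hh hx] :=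
      core_orbit_param_surj (core_orbit_sym (core_orbit_reprP x)).
    by exists (h, core_orbit_repr x) => //; split=> //; exists x.
  apply: Xorb Xx; apply: core_orbit_trans (core_orbit_reprP x) _.
  exact: core_orbit_paramP.
apply: inj_card_eq => -[g x'] [h y'] /set_mem[/= Hg [x _ xx']].
move=> /set_mem[/= Hh [y _ yy']]; rewrite /F /= => eqF.
(* The representative is recovered from the image, as parametrization stays within one class;
   injectivity then reduces to a single class. *)
have orbF u u' a : H a -> core_orbit_repr u = u' ->
    core_orbit_repr (core_orbit_param u' a) = u'.
  move=> Ha uu'; rewrite -[RHS]uu'; apply/esym/core_orbit_repr_eq.
  apply: core_orbit_trans (core_orbit_reprP u) _.
  by rewrite uu'; apply: core_orbit_paramP.
have xy : x' = y' by rewrite -(orbF _ _ _ Hg xx') eqF (orbF _ _ _ Hh yy').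
by move: eqF; rewrite xy => /(core_orbit_param_inj Hg Hh) ->.
Qed.

End Core.

Theorem corollary4 (G : groupType) (H : set G) (k : int)
    (subgH : group_closed (mem H)) :
  card_dvd H [set x : G | H (expgz x k)].
Proof.
apply: card_dvd_core_orbit => // x y; exact: core_orbit_expgz.
Qed.
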